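(* Let $Y$ be a Banach space over $\mathbb{K}$ ($=\mathbb{R}$ or $\mathbb{C}$). The pair $(\ell_1,Y)$ has the BPBZp if and only if $Y$ has the $Y^*$-AHSp.
   Context: $B_X$ and $S_X$ are the closed unit ball and unit sphere of a Banach space $X$, $X^*$ its topological dual, $\mathcal{L}(X,Y)$ the bounded linear operators from $X$ to $Y$. BPBZp (Bishop-Phelps-Bollobás-Zizler property): a pair $(X,Y)$ of Banach spaces has the BPBZp if for every $\varepsilon>0$ there exists $\eta(\varepsilon)>0$ such that whenever $T\in\mathcal{L}(X,Y)$ with $\|T\|=1$, $y_0^*\in S_{Y^*}$ and $x_0\in S_X$ satisfy $|y_0^*(Tx_0)|>1-\eta(\varepsilon)$, there exist $y_1^*\in S_{Y^*}$, $x_1\in S_X$ and $S\in\mathcal{L}(X,Y)$ with $\|S\|=|y_1^*(Sx_1)|=1$, $\|x_1-x_0\|<\varepsilon$, $\|y_1^*-y_0^*\|<\varepsilon$ and $\|S-T\|<\varepsilon$. $Z$-AHSp: let $X$ be a Banach space and $Z$ a subspace of $X^*$. $X$ has the $Z$-AHSp if for every $\varepsilon>0$ there is $\eta(\varepsilon)>0$ such that whenever $\{x_k\}_{k\in\mathbb{N}}\subset B_X$, $x^*\in S_Z$ and $a=(a_k)\in S_{\ell_1}$ with $a_k\ge 0$ for all $k$ satisfy $\operatorname{Re} x^*\left(\sum_{k=1}^\infty a_kx_k\right)>1-\eta(\varepsilon)$, there are $A\subset\mathbb{N}$, $\{z_k\}_{k\in A}\subset S_X$ and $z^*\in S_Z$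 such that (i) $\sum_{k\in A}a_k>1-\varepsilon$, (ii) $\|z_k-x_k\|<\varepsilon$ for all $k\in A$, (iii) $z^*(z_k)=1$ for all $k\in A$, (iv) $\|z^*-x^*\|<\varepsilon$. The $Y^*$-AHSp for $Y$ is the case $X=Y$, $Z=Y^*$. *)

(* Defs.v *)
From Stdlib Require Import Reals Lra Lia.
From Stdlib Require Import ClassicalEpsilon FunctionalExtensionality
  PropExtensionality ProofIrrelevance.
From Coquelicot Require Import Coquelicot.
Open Scope R_scope.

Inductive scalar_field : Set := Reals | Complexes.

Definition scalars (k : scalar_field) : AbsRing :=
  match k with Reals => R_AbsRing | Complexes => C_AbsRing end.

Definition scalar_Re (k : scalar_field) : scalars k -> R :=
  match k with Reals => fun x => x | Complexes => fun z => Re z end.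

Definition scalar_of_R (k : scalar_field) : R -> scalars k :=
  match k with Reals => fun x => x | Complexes => RtoC end.

Lemma scalars_complete (k : scalar_field) (u : nat -> scalars k) :
  (forall eps : R, 0 < eps -> exists N : nat, forall n m : nat,
     (N <= n)%nat -> (N <= m)%nat -> abs (minus (u n) (u m)) < eps) ->
  exists l : scalars k, forall eps : R, 0 < eps -> exists N : nat,
    forall n : nat, (N <= n)%nat -> abs (minus (u n) l) < eps.
Proof.
destruct k; simpl in *; intros Hu.
- assert (Cu : Cauchy_crit u).
  { intros e He. destruct (Hu e He) as [N HN].
    exists N; intros n m Hn Hm. apply (HN n m); lia. }
  destruct (Rcomplete.R_complete u Cu) as [l Hl].
  exists l; intros e He. destruct (Hl e He) as [N HN].
  exists N; intros n Hn; apply (HN n); lia.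
- assert (Cr : Cauchy_crit (fun n => Re (u n))).
  { intros e He. destruct (Hu e He) as [N HN].
    exists N; intros n m Hn Hm.
    eapply Rle_lt_trans; [| apply (HN n m); lia].
    eapply Rle_trans; [| apply Rmax_Cmod].
    eapply Rle_trans; [| apply Rmax_l]. right; reflexivity. }
  assert (Cm : Cauchy_crit (fun n => Im (u n))).
  { intros e He. destruct (Hu e He) as [N HN].
    exists N; intros n m Hn Hm.
    eapply Rle_lt_trans; [| apply (HN n m); lia].
    eapply Rle_trans; [| apply Rmax_Cmod].
    eapply Rle_trans; [| apply Rmax_r]. right; reflexivity. }
  destruct (Rcomplete.R_complete _ Cr) as [lr Hr], (Rcomplete.R_complete _ Cm) as [li Hi].
  exists (lr, li); intros e He.
  assert (He4 : 0 < e / 4) by lra.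
  destruct (Hr _ He4) as [N1 H1], (Hi _ He4) as [N2 H2].
  exists (N1 + N2)%nat; intros n Hn.
  specialize (H1 n ltac:(lia)); specialize (H2 n ltac:(lia)).
  unfold Rdist in H1, H2.
  set (z := minus (u n) (lr, li)).
  assert (Ez : z = Cplus (RtoC (Re (u n) - lr)) (Cmult Ci (RtoC (Im (u n) - li)))).
  { unfold z; destruct (u n) as [p q]; simpl.
    unfold Cplus, Cmult, RtoC, Ci; simpl.
    apply injective_projections; simpl; unfold minus, plus, opp; simpl; ring. }
  change (Cmod z < e). rewrite Ez.
  eapply Rle_lt_trans; [apply Cmod_triangle |].
  rewrite Cmod_mult, !Cmod_R, Cmod_Ci. lra.
Qed.

Section L1.
Context {K : AbsRing}.

Record l1_seq : Type := L1Seq {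
  l1_fun :> nat -> K;
  l1_summable : ex_series (fun n => abs (l1_fun n))
}.

Lemma l1_eq (u v : l1_seq) : (forall n, u n = v n) -> u = v.
Proof.
destruct u as [u Hu], v as [v Hv]; simpl; intros E.
assert (E' : u = v) by (apply functional_extensionality; exact E).
subst v; f_equal; apply proof_irrelevance.
Qed.

Lemma ex_series_abs_le (a : nat -> K) (b : nat -> R) :
  (forall n, abs (a n) <= b n) -> ex_series b -> ex_series (fun n => abs (a n)).
Proof.
intros Hab Hb.
apply (@ex_series_le R_AbsRing R_CompleteNormedModule _ b); [| exact Hb].
intros n; change (Rabs (abs (a n)) <= b n).
rewrite Rabs_pos_eq; [apply Hab | apply abs_ge_0].
Qed.

Lemma l1_zero_summable : ex_series (fun n : nat => abs (@zero K)).
Proof.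
apply (ex_series_ext (fun n => scal 0 (0 ^ n))).
- intros n; rewrite abs_zero; apply Rmult_0_l.
- apply (@ex_series_scal_l R_AbsRing R_NormedModule), ex_series_geom.
  rewrite Rabs_R0; lra.
Qed.

Lemma l1_plus_summable (u v : l1_seq) :
  ex_series (fun n => abs (plus (u n) (v n))).
Proof.
apply (ex_series_abs_le _ (fun n => abs (u n) + abs (v n))).
- intros n; apply abs_triangle.
- apply (@ex_series_plus R_AbsRing R_NormedModule); apply l1_summable.
Qed.

Lemma l1_opp_summable (u : l1_seq) : ex_series (fun n => abs (opp (u n))).
Proof.
apply (ex_series_ext (fun n => abs (u n))); [| apply l1_summable].
intros n; symmetry; apply abs_opp.
Qed.

Lemma l1_scal_summable (c : K) (u : l1_seq) :
  ex_series (fun n => abs (mult c (u n))).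
Proof.
apply (ex_series_abs_le _ (fun n => abs c * abs (u n))).
- intros n; apply abs_mult.
- apply (@ex_series_scal_l R_AbsRing R_NormedModule); apply l1_summable.
Qed.

Definition l1_zero : l1_seq := L1Seq (fun _ => zero) l1_zero_summable.
Definition l1_plus (u v : l1_seq) : l1_seq :=
  L1Seq (fun n => plus (u n) (v n)) (l1_plus_summable u v).
Definition l1_opp (u : l1_seq) : l1_seq :=
  L1Seq (fun n => opp (u n)) (l1_opp_summable u).
Definition l1_scal (c : K) (u : l1_seq) : l1_seq :=
  L1Seq (fun n => mult c (u n)) (l1_scal_summable c u).
Definition l1_norm (u : l1_seq) : R := Series (fun n => abs (u n)).

Definition l1_AbelianMonoid_mixin : AbelianMonoid.mixin_of l1_seq.
Proof.
apply (AbelianMonoid.Mixin l1_seq l1_plus l1_zero);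
  intros; apply l1_eq; intros n; simpl.
- apply plus_comm.
- apply plus_assoc.
- apply plus_zero_r.
Defined.

Canonical l1_AbelianMonoid := AbelianMonoid.Pack l1_seq l1_AbelianMonoid_mixin l1_seq.

Definition l1_AbelianGroup_mixin : AbelianGroup.mixin_of l1_AbelianMonoid.
Proof.
apply (AbelianGroup.Mixin l1_AbelianMonoid l1_opp).
intros x; apply l1_eq; intros n; exact (plus_opp_r (x n)).
Defined.

Canonical l1_AbelianGroup :=
  AbelianGroup.Pack l1_seq (AbelianGroup.Class _ _ l1_AbelianGroup_mixin) l1_seq.

Definition l1_ModuleSpace_mixin : ModuleSpace.mixin_of K l1_AbelianGroup.
Proof.
apply (ModuleSpace.Mixin K l1_AbelianGroup l1_scal);
  intros; apply l1_eq; intros n; simpl.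
- apply mult_assoc.
- apply mult_one_l.
- exact (mult_distr_l (K := K) _ _ _).
- exact (mult_distr_r (K := K) _ _ _).
Defined.

Canonical l1_ModuleSpace :=
  ModuleSpace.Pack K l1_seq (ModuleSpace.Class _ _ _ l1_ModuleSpace_mixin) l1_seq.

Lemma l1_norm_ge (u : l1_seq) (N : nat) :
  sum_n (fun n => abs (u n)) N <= l1_norm u.
Proof.
apply (is_lim_seq_incr_compare (sum_n (fun n => abs (u n))) (l1_norm u)).
- exact (Series_correct _ (l1_summable u)).
- intros n; rewrite sum_Sn; unfold plus; simpl.
  generalize (abs_ge_0 (u (S n))); lra.
Qed.

Lemma l1_norm_abs_le (u : l1_seq) (n : nat) : abs (u n) <= l1_norm u.
Proof.
eapply Rle_trans; [| apply (l1_norm_ge u n)].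
destruct n; [rewrite sum_O; lra |].
rewrite sum_Sn; unfold plus; simpl.
enough (0 <= sum_n (fun n => abs (u n)) n) by lra.
induction n; [rewrite sum_O; apply abs_ge_0 |].
rewrite sum_Sn; unfold plus; simpl.
generalize (abs_ge_0 (u (S n))); lra.
Qed.

Lemma l1_norm_triangle (u v : l1_seq) :
  l1_norm (plus u v) <= l1_norm u + l1_norm v.
Proof.
unfold l1_norm.
rewrite <- Series_plus by apply l1_summable.
apply Series_le.
- intros n; split; [apply abs_ge_0 | apply abs_triangle].
- apply (@ex_series_plus R_AbsRing R_NormedModule); apply l1_summable.
Qed.

Lemma l1_norm_scal (c : K) (u : l1_seq) :
  l1_norm (scal c u) <= abs c * l1_norm u.
Proof.
unfold l1_norm; rewrite <- Series_scal_l.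
apply Series_le.
- intros n; split; [apply abs_ge_0 | apply abs_mult].
- apply (@ex_series_scal_l R_AbsRing R_NormedModule); apply l1_summable.
Qed.

Lemma l1_norm_eq_zero (u : l1_seq) : l1_norm u = 0 -> u = zero.
Proof.
intros H; apply l1_eq; intros n; apply abs_eq_zero.
apply Rle_antisym; [rewrite <- H; apply l1_norm_abs_le | apply abs_ge_0].
Qed.

Lemma l1_norm_minus_self (u : l1_seq) : l1_norm (minus u u) = 0.
Proof.
replace (minus u u) with (@zero l1_AbelianGroup)
  by (symmetry; apply plus_opp_r).
unfold l1_norm; simpl.
rewrite (Series_ext _ (fun _ => 0 * 0)).
- rewrite Series_scal_l; apply Rmult_0_l.
- intros n; rewrite abs_zero; symmetry; apply Rmult_0_l.
Qed.

Lemma l1_norm_minus_sym (u v : l1_seq) : l1_norm (minus u v) = l1_norm (minus v u).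
Proof.
unfold l1_norm; apply Series_ext; intros n; apply abs_minus.
Qed.

Lemma l1_norm_minus_trans (u v w : l1_seq) :
  l1_norm (minus u w) <= l1_norm (minus u v) + l1_norm (minus v w).
Proof.
rewrite (minus_trans v u w); apply l1_norm_triangle.
Qed.

Definition l1_ball (u : l1_seq) (eps : R) (v : l1_seq) : Prop :=
  l1_norm (minus v u) < eps.

Definition l1_UniformSpace_mixin : UniformSpace.mixin_of l1_seq.
Proof.
apply (UniformSpace.Mixin l1_seq l1_zero l1_ball); unfold l1_ball.
- intros u e; rewrite l1_norm_minus_self; apply cond_pos.
- intros u v e; rewrite l1_norm_minus_sym; easy.
- intros u v w e1 e2 H1 H2.
  generalize (l1_norm_minus_trans w v u); lra.
Defined.

Canonical l1_UniformSpace := UniformSpace.Pack l1_seq l1_UniformSpace_mixin l1_seq.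

Canonical l1_NormedModuleAux :=
  NormedModuleAux.Pack K l1_seq
    (NormedModuleAux.Class _ _ (ModuleSpace.class K l1_ModuleSpace)
       (UniformSpace.class l1_UniformSpace)) l1_seq.

Definition l1_NormedModule_mixin : NormedModule.mixin_of K l1_NormedModuleAux.
Proof.
apply (NormedModule.Mixin K l1_NormedModuleAux l1_norm 1).
- exact l1_norm_triangle.
- exact l1_norm_scal.
- intros u v e H; exact H.
- intros u v e H; rewrite Rmult_1_l; exact H.
- exact l1_norm_eq_zero.
Defined.

Canonical l1_NormedModule :=
  NormedModule.Pack K l1_seq
    (NormedModule.Class _ _ (NormedModuleAux.class K l1_NormedModuleAux)
       l1_NormedModule_mixin) l1_seq.

Context (K_complete : forall u : nat -> K,
  (forall eps : R, 0 < eps -> exists N : nat, forall n m : nat,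
     (N <= n)%nat -> (N <= m)%nat -> abs (minus (u n) (u m)) < eps) ->
  exists l : K, forall eps : R, 0 < eps -> exists N : nat,
    forall n : nat, (N <= n)%nat -> abs (minus (u n) l) < eps).

Lemma l1_norm_bounded (u : nat -> K) (M : R) :
  (forall N, sum_n (fun n => abs (u n)) N <= M) ->
  exists H : ex_series (fun n => abs (u n)), l1_norm (L1Seq u H) <= M.
Proof.
intros HM.
assert (Hincr : forall n, sum_n (fun n => abs (u n)) n
                          <= sum_n (fun n => abs (u n)) (S n)).
{ intros n; rewrite sum_Sn; unfold plus; simpl.
  generalize (abs_ge_0 (u (S n))); lra. }
destruct (ex_finite_lim_seq_incr _ M Hincr HM) as [l Hl].
exists (ex_intro _ l Hl).
unfold l1_norm; simpl; rewrite (is_series_unique _ l Hl).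
apply (is_lim_seq_le _ (fun _ => M) l M HM Hl (is_lim_seq_const M)).
Qed.

Lemma l1_Cauchy_seq (x : nat -> l1_seq) (d : nat -> R) :
  is_lim_seq d 0 ->
  (forall n m, l1_norm (minus (x n) (x m)) <= d n + d m) ->
  exists l : l1_seq, forall n, l1_norm (minus (x n) l) <= d n.
Proof.
intros Hd Hx.
assert (Hd' : forall e, 0 < e -> exists N, forall n, (N <= n)%nat -> d n < e).
{ intros e He. apply is_lim_seq_spec in Hd.
  destruct (Hd (mkposreal e He)) as [N HN]; exists N; intros n Hn.
  specialize (HN n Hn); simpl in HN.
  apply Rabs_def2 in HN; lra. }
assert (Hl : forall i, exists l : K, forall eps : R, 0 < eps -> exists N : nat,
  forall n : nat, (N <= n)%nat -> abs (minus (x n i) l) < eps).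
{ intros i; apply K_complete; intros e He.
  destruct (Hd' (e / 2)) as [N HN]; [lra |].
  exists N; intros n m Hn Hm.
  assert (Hi : abs (minus (x n i) (x m i)) <= l1_norm (minus (x n) (x m)))
    by exact (l1_norm_abs_le (minus (x n) (x m)) i).
  specialize (HN n Hn) as HNn; specialize (HN m Hm) as HNm.
  specialize (Hx n m); lra. }
apply choice in Hl; destruct Hl as [l Hl].
assert (Hsum : forall n N, sum_n (fun i => abs (minus (x n i) (l i))) N <= d n).
{ intros n N.
  apply le_epsilon; intros e He.
  assert (Hun : forall (N : nat) (e : R), 0 < e -> exists M, forall m, (M <= m)%nat ->
     sum_n (fun i => abs (minus (x m i) (l i))) N <= e).
  { clear N e He; intros N; induction N; intros e He.
    - destruct (Hl 0%nat e He) as [M HM]; exists M; intros m Hm.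
      rewrite sum_O; apply Rlt_le, HM, Hm.
    - destruct (Hl (S N) (e / 2)) as [M HM]; [lra |].
      destruct (IHN (e / 2)) as [M' HM']; [lra |].
      exists (M + M')%nat; intros m Hm.
      rewrite sum_Sn; unfold plus; simpl.
      specialize (HM m ltac:(lia)); specialize (HM' m ltac:(lia)); simpl in *; lra. }
  destruct (Hun N (e / 2)) as [M HM]; [lra |].
  destruct (Hd' (e / 2)) as [M' HM']; [lra |].
  set (m := (M + M')%nat).
  specialize (HM m ltac:(lia)); specialize (HM' m ltac:(lia)).
  apply Rle_trans with (sum_n (fun i => abs (minus (x n i) (x m i))
                                 + abs (minus (x m i) (l i))) N).
  - apply sum_n_m_le; intros i.
    rewrite (minus_trans (x m i) (x n i) (l i)); apply abs_triangle.
  - change (sum_n (fun i => plus (abs (minus (x n i) (x m i)))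
                                 (abs (minus (x m i) (l i)))) N <= d n + e).
    rewrite sum_n_plus; unfold plus at 1; simpl.
    generalize (l1_norm_ge (minus (x n) (x m)) N) (Hx n m).
    change (fun i => abs ((minus (x n) (x m) : l1_seq) i))
      with (fun i => abs (minus (x n i) (x m i))).
    simpl in *; lra. }
assert (Hls : ex_series (fun i => abs (l i))).
{ destruct (l1_norm_bounded _ _ (Hsum 0%nat)) as [H _].
  apply (ex_series_abs_le _ (fun i => abs (minus (x 0%nat i) (l i)) + abs (x 0%nat i))).
  - intros i. rewrite (abs_minus (x 0%nat i)).
    replace (l i) with (plus (minus (l i) (x 0%nat i)) (x 0%nat i)) at 1;
      [apply abs_triangle |].
    unfold minus; rewrite <- plus_assoc, plus_opp_l; apply plus_zero_r.
  - apply (@ex_series_plus R_AbsRing R_NormedModule); [exact H | apply l1_summable]. }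
exists (L1Seq l Hls); intros n.
destruct (l1_norm_bounded _ _ (Hsum n)) as [H HM].
replace (minus (x n) (L1Seq l Hls)) with (L1Seq _ H); [exact HM |].
apply l1_eq; reflexivity.
Qed.

Lemma l1_filter_complete (F : (l1_seq -> Prop) -> Prop) :
  ProperFilter F -> cauchy F ->
  exists l : l1_seq, forall eps : posreal, F (ball l eps).
Proof.
intros PF CF.
set (d := fun n : nat => RinvN n : R).
assert (Hd : is_lim_seq d 0) by exact (proj2 (is_lim_seq_Reals _ 0) RinvN_cv).
assert (Hx : forall n : nat, exists x : l1_seq, F (ball x (d n)))
  by (intros n; apply CF).
apply choice in Hx; destruct Hx as [x Hx].
destruct (l1_Cauchy_seq x d Hd) as [l Hl].
- intros n m.
  destruct (filter_ex _ (filter_and _ _ (Hx n) (Hx m))) as [y [Hn Hm]].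
  change (l1_norm (minus y (x n)) < d n) in Hn.
  change (l1_norm (minus y (x m)) < d m) in Hm.
  rewrite l1_norm_minus_sym in Hn.
  generalize (l1_norm_minus_trans (x n) y (x m)); lra.
- exists l; intros e.
  apply is_lim_seq_spec in Hd.
  destruct (Hd (pos_div_2 e)) as [n Hn].
  specialize (Hn n (le_n n)); simpl in Hn; apply Rabs_def2 in Hn.
  generalize (Hx n); apply filter_imp; intros y Hy.
  change (l1_norm (minus y (x n)) < d n) in Hy.
  change (l1_norm (minus y l) < e).
  generalize (l1_norm_minus_trans y (x n) l) (Hl n); lra.
Qed.

Lemma filter_le_antisym (F1 F2 : (l1_seq -> Prop) -> Prop) :
  filter_le F1 F2 -> filter_le F2 F1 -> F1 = F2.
Proof.
intros H12 H21; apply functional_extensionality; intros P.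
apply propositional_extensionality; split; [apply H21 | apply H12].
Qed.

Definition l1_lim (F : (l1_seq -> Prop) -> Prop) : l1_seq :=
  epsilon (inhabits l1_zero) (fun l => forall eps : posreal, F (ball l eps)).

Definition l1_CompleteSpace_mixin : CompleteSpace.mixin_of l1_UniformSpace.
Proof.
apply (CompleteSpace.Mixin l1_UniformSpace l1_lim).
- intros F PF CF; unfold l1_lim; apply epsilon_spec.
  exact (l1_filter_complete F PF CF).
- intros F1 F2 H12 H21; rewrite (filter_le_antisym F1 F2 H12 H21).
  apply close_refl.
Defined.

End L1.

Arguments l1_seq : clear implicits.
Arguments l1_NormedModule : clear implicits.
Arguments l1_CompleteSpace_mixin : clear implicits.

Canonical l1 (k : scalar_field) : CompleteNormedModule (scalars k) :=
  CompleteNormedModule.Pack (scalars k) (l1_seq (scalars k))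
    (CompleteNormedModule.Class _ _
       (NormedModule.class (scalars k) (l1_NormedModule (scalars k)))
       (l1_CompleteSpace_mixin (scalars k) (scalars_complete k)))
    (l1_seq (scalars k)).

(* Elements of L(X, Y) are plain functions satisfying Coquelicot's [is_linear],
   which includes boundedness.  For those the supremum is finite. *)
Definition opnorm {K : AbsRing} {X Y : NormedModule K} (T : X -> Y) : R :=
  real (Lub_Rbar (fun r => exists x : X, norm x <= 1 /\ r = norm (T x))).

Definition opdist {K : AbsRing} {X Y : NormedModule K} (S T : X -> Y) : R :=
  opnorm (fun x => minus (S x) (T x)).

Section Properties.
Context {k : scalar_field}.
Local Notation K := (scalars k).

Definition functional (X : CompleteNormedModule K) : Type :=
  X -> AbsRing_NormedModule K.

Record dual_subspace (X : CompleteNormedModule K) : Type := DualSubspace {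
  dual_mem :> functional X -> Prop;
  dual_mem_linear : forall f, dual_mem f -> is_linear f;
  dual_mem_zero : dual_mem (fun _ => zero);
  dual_mem_plus : forall f g,
    dual_mem f -> dual_mem g -> dual_mem (fun x => plus (f x) (g x));
  dual_mem_scal : forall (c : K) f,
    dual_mem f -> dual_mem (fun x => scal c (f x))
}.

Lemma scalars_mult_comm (x y : K) : mult x y = mult y x.
Proof.
destruct k; [exact (Rmult_comm x y) | exact (Cmult_comm x y)].
Qed.

Lemma is_linear_scal_fun (X : CompleteNormedModule K) (c : K) (f : functional X) :
  is_linear f -> is_linear (fun x => scal c (f x) : AbsRing_NormedModule K).
Proof.
intros Hf.
apply (is_linear_comp f (fun y : AbsRing_NormedModule K => scal c y) Hf).
apply is_linear_scal_r, scalars_mult_comm.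
Qed.

Lemma is_linear_plus_fun (X : CompleteNormedModule K) (f g : functional X) :
  is_linear f -> is_linear g ->
  is_linear (fun x => plus (f x) (g x) : AbsRing_NormedModule K).
Proof.
intros Hf Hg.
apply (is_linear_comp (fun x => (f x, g x)) (fun u => plus (fst u) (snd u))).
- apply is_linear_prod; assumption.
- apply is_linear_plus.
Qed.

Definition dual (X : CompleteNormedModule K) : dual_subspace X :=
  DualSubspace X (fun f => is_linear f) (fun f Hf => Hf) is_linear_zero
    (is_linear_plus_fun X) (is_linear_scal_fun X).

Definition BPBZp (X Y : CompleteNormedModule K) : Prop :=
  forall eps : R, 0 < eps -> exists eta : R, 0 < eta /\
    forall (T : X -> Y) (y0' : functional Y) (x0 : X),
      is_linear T -> opnorm T = 1 ->
      dual Y y0' -> opnorm y0' = 1 ->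
      norm x0 = 1 ->
      abs (y0' (T x0)) > 1 - eta ->
      exists (y1' : functional Y) (x1 : X) (S : X -> Y),
        dual Y y1' /\ opnorm y1' = 1 /\
        norm x1 = 1 /\
        is_linear S /\ opnorm S = 1 /\ abs (y1' (S x1)) = 1 /\
        norm (minus x1 x0) < eps /\
        opdist y1' y0' < eps /\
        opdist S T < eps.

Definition restrict (A : nat -> Prop) (a : nat -> R) (n : nat) : R :=
  if excluded_middle_informative (A n) then a n else 0.

(* The weights are nonnegative reals, so they are taken in the real l1 for both
   choices of [k]; the values [z n] for [n] outside [A] are irrelevant. *)
Definition AHSp (X : CompleteNormedModule K) (Z : dual_subspace X) : Prop :=
  forall eps : R, 0 < eps -> exists eta : R, 0 < eta /\
    forall (x : nat -> X) (x' : functional X) (a : l1 Reals) (s : X),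
      (forall n, norm (x n) <= 1) ->
      Z x' -> opnorm x' = 1 ->
      norm a = 1 -> (forall n, 0 <= (a n : R)) ->
      is_series (fun n => scal (scalar_of_R k (a n)) (x n)) s ->
      scalar_Re k (x' s) > 1 - eta ->
      exists (A : nat -> Prop) (z : nat -> X) (z' : functional X),
        (forall n, A n -> norm (z n) = 1) /\
        Z z' /\ opnorm z' = 1 /\
        Series (restrict A a) > 1 - eps /\
        (forall n, A n -> norm (minus (z n) (x n)) < eps) /\
        (forall n, A n -> z' (z n) = one) /\
        opdist z' x' < eps.

End Properties.

(* Main.v *)
(* A bounded operator T from l1 to Y is the same thing as the bounded sequence
   (T e_n), with norm sup |T e_n|.

   From BPBZp to AHSp: apply BPBZp to the normalisation of the operator e_n |-> x_n
   at the point a.  The new operator S attains its norm through y at some u, so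
   y (S e_n) has modulus one wherever u n <> 0; rotating S e_n by the inverse of
   this scalar gives z_n.  The rotation is close to the identity where
   Re x'(x_n) > 1 - d, and such n with u n <> 0 carry almost all the mass of a.

   From AHSp to BPBZp: take a_n = |x0 n| and let x_n be T e_n rotated by the phase
   of x0 n (and by a common phase making y0 (T x0) positive).  Rotating back the
   z_n given by AHSp, and keeping T e_n for n outside A, defines S, which attains
   its norm at the normalised restriction of x0 to A. *)
Require Import Defs.
From Stdlib Require Import Reals Arith Lra Lia ClassicalEpsilon.
From Coquelicot Require Import Coquelicot.
Open Scope R_scope.

(** * Scalar arithmetic, uniform in the real and complex cases *)

Lemma abs_mult_eq (k : scalar_field) (x y : scalars k) :
  abs (mult x y) = abs x * abs y.
Proof. destruct k; [exact (Rabs_mult x y) | exact (Cmod_mult x y)]. Qed.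

Lemma abs_scalar_of_R (k : scalar_field) (r : R) : abs (scalar_of_R k r) = Rabs r.
Proof. destruct k; [reflexivity | exact (Cmod_R r)]. Qed.

Lemma scalar_of_R_one (k : scalar_field) : scalar_of_R k 1 = one.
Proof. destruct k; reflexivity. Qed.

Lemma scalar_of_R_mult (k : scalar_field) (r s : R) :
  scalar_of_R k (r * s) = mult (scalar_of_R k r) (scalar_of_R k s).
Proof. destruct k; [reflexivity | exact (RtoC_mult r s)]. Qed.

Lemma scalar_of_R_minus (k : scalar_field) (r s : R) :
  scalar_of_R k (r - s) = minus (scalar_of_R k r) (scalar_of_R k s).
Proof. destruct k; [reflexivity | exact (RtoC_minus r s)]. Qed.

Lemma scalar_Re_of_R (k : scalar_field) (r : R) : scalar_Re k (scalar_of_R k r) = r.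
Proof. destruct k; reflexivity. Qed.

Lemma scalar_Re_plus (k : scalar_field) (x y : scalars k) :
  scalar_Re k (plus x y) = scalar_Re k x + scalar_Re k y.
Proof. destruct k; reflexivity. Qed.

Lemma scalar_Re_minus (k : scalar_field) (x y : scalars k) :
  scalar_Re k (minus x y) = scalar_Re k x - scalar_Re k y.
Proof. destruct k; reflexivity. Qed.

Lemma scalar_Re_mult_of_R (k : scalar_field) (r : R) (w : scalars k) :
  scalar_Re k (mult (scalar_of_R k r) w) = r * scalar_Re k w.
Proof.
destruct k; [reflexivity |].
change (r * Re w - 0 * Im w = r * Re w). ring.
Qed.

Lemma Rabs_scalar_Re_le (k : scalar_field) (w : scalars k) :
  Rabs (scalar_Re k w) <= abs w.
Proof. destruct k; [right; reflexivity | exact (re_le_Cmod w)]. Qed.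

Lemma scalar_Re_le_abs (k : scalar_field) (w : scalars k) : scalar_Re k w <= abs w.
Proof. eapply Rle_trans; [apply Rle_abs | apply Rabs_scalar_Re_le]. Qed.

Lemma scalar_inverse (k : scalar_field) (w : scalars k) :
  w <> zero -> exists c : scalars k, mult c w = one.
Proof.
intros Hw; destruct k.
- exists (Rinv w); exact (Rinv_l w Hw).
- exists (Cinv w); exact (Cinv_l w Hw).
Qed.

Lemma abs_inverse (k : scalar_field) (c w : scalars k) :
  mult c w = one -> abs c * abs w = 1.
Proof.
intros E; rewrite <- abs_mult_eq, E, <- scalar_of_R_one, abs_scalar_of_R.
apply Rabs_R1.
Qed.

Lemma abs_inverse_unit (k : scalar_field) (c w : scalars k) :
  abs w = 1 -> mult c w = one -> abs c = 1.
Proof. intros Hw E; apply abs_inverse in E; rewrite Hw in E; lra. Qed.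

(** The inverse is the conjugate of [w], and expanding the square gives |w|^2 - 2 Re w + 1. This
    quantifies how little a rotation by [c] moves a vector when Re w is near 1. *)
Lemma scalar_unit_inverse (k : scalar_field) (w : scalars k) :
  abs w = 1 -> exists c : scalars k, mult c w = one /\
    abs (minus c one) ^ 2 = 2 * (1 - scalar_Re k w).
Proof.
destruct k; simpl scalar_Re; intros Hw.
- exists w; change (Rabs w = 1) in Hw.
  change (w * w = 1 /\ Rabs (w - 1) ^ 2 = 2 * (1 - w)).
  assert (H2 : w * w = 1).
  { generalize (Rsqr_abs w); unfold Rsqr; rewrite Hw; lra. }
  split; [exact H2 |].
  rewrite pow2_abs; simpl; lra.
- exists (Cconj w); change (Cmod w = 1) in Hw.
  change (Cmult (Cconj w) w = RtoC 1 /\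
    Cmod (Cminus (Cconj w) (RtoC 1)) ^ 2 = 2 * (1 - Re w)).
  split.
  + rewrite Cmult_comm, <- Cmod2_conj, Hw; f_equal; ring.
  + assert (H := Cmod2_alt w); rewrite Hw in H.
    rewrite Cmod2_alt; destruct w as [p q]; simpl in *; lra.
Qed.

(** The phase is w / |w|; at w = 0 any unit scalar works and [one] is taken. *)
Lemma scalar_phase (k : scalar_field) (w : scalars k) :
  exists s : scalars k, abs s = 1 /\ w = mult (scalar_of_R k (abs w)) s.
Proof.
destruct (Req_dec (abs w) 0) as [H0 | H0].
- exists one; split.
  + rewrite <- scalar_of_R_one, abs_scalar_of_R; apply Rabs_R1.
  + rewrite (abs_eq_zero w H0) at 1; rewrite H0.
    destruct k; symmetry; [apply Rmult_0_l | apply Cmult_0_l].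
- exists (mult (scalar_of_R k (/ abs w)) w); split.
  + rewrite abs_mult_eq, abs_scalar_of_R, Rabs_pos_eq.
    * now apply Rinv_l.
    * apply Rlt_le, Rinv_0_lt_compat; generalize (abs_ge_0 w); lra.
  + rewrite mult_assoc, <- scalar_of_R_mult, Rinv_r, scalar_of_R_one by easy.
    symmetry; apply mult_one_l.
Qed.

(** * Homogeneity of the norm and the operator norm *)

(** For nonzero c, the inequality [norm_scal] applied to the inverse of c yields the reverse
    inequality, because the two moduli multiply to 1. *)
Lemma norm_scal_eq (k : scalar_field) (V : NormedModule (scalars k))
  (c : scalars k) (x : V) : norm (scal c x) = abs c * norm x.
Proof.
apply Rle_antisym; [apply norm_scal |].
destruct (excluded_middle_informative (c = zero)) as [-> | Hc].
- rewrite abs_zero, Rmult_0_l; apply norm_ge_0.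
- destruct (scalar_inverse k c Hc) as [d Hd].
  replace (norm x) with (norm (scal d (scal c x)))
    by (rewrite scal_assoc, Hd, scal_one; reflexivity).
  apply Rle_trans with (abs c * (abs d * norm (scal c x))).
  + apply Rmult_le_compat_l; [apply abs_ge_0 | apply norm_scal].
  + rewrite <- Rmult_assoc, (Rmult_comm (abs c)), (abs_inverse k d c Hd).
    lra.
Qed.

Lemma is_linear_minus_fun (K : AbsRing) (X Y : NormedModule K) (S T : X -> Y) :
  is_linear S -> is_linear T -> is_linear (fun x => minus (S x) (T x)).
Proof.
intros HS HT.
apply (is_linear_comp (fun x => (S x, opp (T x))) (fun u => plus (fst u) (snd u))).
- apply is_linear_prod; [exact HS |].
  exact (is_linear_comp T opp HT is_linear_opp).
- apply is_linear_plus.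
Qed.

(** The extended supremum lies between 0, attained at the zero vector, and a bound [M] of [T]; hence
    it is finite and taking [real] loses nothing. *)
Lemma opnorm_is_lub (K : AbsRing) (X Y : NormedModule K) (T : X -> Y) :
  is_linear T ->
  is_lub_Rbar (fun r => exists x : X, norm x <= 1 /\ r = norm (T x)) (opnorm T).
Proof.
intros HT; destruct (linear_norm T HT) as [M [HM HTM]].
set (E := fun r => exists x : X, norm x <= 1 /\ r = norm (T x)).
assert (H := Lub_Rbar_correct E); unfold opnorm; fold E.
assert (H0 : Rbar_le 0 (Lub_Rbar E)).
{ apply H; exists zero; rewrite (linear_zero T HT), !norm_zero; lra. }
assert (H1 : Rbar_le (Lub_Rbar E) M).
{ apply H; intros r [x [Hx ->]]; simpl.
  eapply Rle_trans; [apply HTM |].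
  rewrite <- (Rmult_1_r M) at 2; apply Rmult_le_compat_l; lra. }
now destruct (Lub_Rbar E).
Qed.

Lemma opnorm_ball_le (K : AbsRing) (X Y : NormedModule K) (T : X -> Y) (x : X) :
  is_linear T -> norm x <= 1 -> norm (T x) <= opnorm T.
Proof.
intros HT Hx; apply (proj1 (opnorm_is_lub K X Y T HT)); now exists x.
Qed.

Lemma opnorm_le (K : AbsRing) (X Y : NormedModule K) (T : X -> Y) (M : R) :
  is_linear T -> (forall x, norm x <= 1 -> norm (T x) <= M) -> opnorm T <= M.
Proof.
intros HT HM; apply (proj2 (opnorm_is_lub K X Y T HT) M).
intros r [x [Hx ->]]; exact (HM x Hx).
Qed.

Lemma opnorm_ge_0 (K : AbsRing) (X Y : NormedModule K) (T : X -> Y) :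
  is_linear T -> 0 <= opnorm T.
Proof.
intros HT; eapply Rle_trans; [apply (norm_ge_0 (T zero)) |].
apply opnorm_ball_le; [exact HT | rewrite norm_zero; lra].
Qed.

Lemma norm_le_opnorm (k : scalar_field) (X Y : NormedModule (scalars k))
  (T : X -> Y) (x : X) : is_linear T -> norm (T x) <= opnorm T * norm x.
Proof.
intros HT; destruct (Req_dec (norm x) 0) as [H0 | H0].
- rewrite (norm_eq_zero x H0), (linear_zero T HT), !norm_zero; lra.
- assert (Hx : 0 < norm x) by (generalize (norm_ge_0 x); lra).
  assert (H : norm (T (scal (scalar_of_R k (/ norm x)) x)) <= opnorm T).
  { apply opnorm_ball_le; [exact HT |].
    rewrite norm_scal_eq, abs_scalar_of_R, Rabs_pos_eq.
    - rewrite Rinv_l; lra.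
    - now apply Rlt_le, Rinv_0_lt_compat. }
  rewrite (linear_scal T HT), norm_scal_eq, abs_scalar_of_R, Rabs_pos_eq in H
    by now apply Rlt_le, Rinv_0_lt_compat.
  apply (Rmult_le_compat_r (norm x)) in H; [| lra].
  replace (/ norm x * norm (T x) * norm x) with (norm (T x)) in H by (field; lra).
  exact H.
Qed.

Lemma is_linear_scal_op (k : scalar_field) (X Y : NormedModule (scalars k))
  (c : scalars k) (T : X -> Y) : is_linear T -> is_linear (fun x => scal c (T x)).
Proof.
intros HT; apply (is_linear_comp T (fun y => scal c y) HT).
apply is_linear_scal_r, scalars_mult_comm.
Qed.

Lemma opnorm_scal (k : scalar_field) (X Y : NormedModule (scalars k))
  (c : scalars k) (T : X -> Y) :
  is_linear T -> opnorm (fun x => scal c (T x)) = abs c * opnorm T.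
Proof.
intros HT; assert (HcT := is_linear_scal_op k X Y c T HT).
apply Rle_antisym.
- apply opnorm_le; [exact HcT |]; intros x Hx; rewrite norm_scal_eq.
  apply Rmult_le_compat_l; [apply abs_ge_0 | now apply opnorm_ball_le].
- destruct (Req_dec (abs c) 0) as [H0 | H0].
  + rewrite H0, Rmult_0_l; now apply opnorm_ge_0.
  + assert (Hc : 0 < abs c) by (generalize (abs_ge_0 c); lra).
    apply (Rmult_le_reg_l (/ abs c)); [now apply Rinv_0_lt_compat |].
    rewrite <- Rmult_assoc, Rinv_l, Rmult_1_l by easy.
    apply opnorm_le; [exact HT |]; intros x Hx.
    apply (Rmult_le_reg_l (abs c)); [exact Hc |].
    rewrite <- Rmult_assoc, Rinv_r, Rmult_1_l, <- norm_scal_eq by easy.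
    exact (opnorm_ball_le _ _ _ _ x HcT Hx).
Qed.

(** * Convergent series in normed modules *)

Lemma is_series_unique_lim (K : AbsRing) (V : NormedModule K) (a : nat -> V) (l m : V) :
  is_series a l -> is_series a m -> l = m.
Proof. apply filterlim_locally_unique. Qed.

Lemma is_series_linear (K : AbsRing) (U V : NormedModule K) (T : U -> V)
  (a : nat -> U) (l : U) :
  is_linear T -> is_series a l -> is_series (fun n => T (a n)) (T l).
Proof.
intros HT Ha; unfold is_series.
apply (filterlim_ext (fun n => T (sum_n a n))).
- intros n; induction n as [| n IH]; [now rewrite !sum_O |].
  now rewrite !sum_Sn, (linear_plus T HT), IH.
- apply (filterlim_comp _ _ _ (sum_n a) T _ (locally l)); [exact Ha |].
  exact (linear_cont T l HT).
Qed.

(** The real part is not complex-linear, so [is_series_linear] does not cover it; convergence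
    follows from additivity and |Re w| <= |w|. *)
Lemma is_series_scalar_Re (k : scalar_field)
  (a : nat -> AbsRing_NormedModule (scalars k)) (l : AbsRing_NormedModule (scalars k)) :
  is_series a l -> is_series (fun n => scalar_Re k (a n)) (scalar_Re k l).
Proof.
intros Ha; unfold is_series in *.
assert (Hs : forall n, sum_n (fun n => scalar_Re k (a n)) n = scalar_Re k (sum_n a n)).
{ intros n; induction n as [| n IH]; [now rewrite !sum_O |].
  rewrite !sum_Sn, IH; symmetry; apply scalar_Re_plus. }
apply filterlim_locally_ball_norm; intros e.
generalize (proj1 (filterlim_locally_ball_norm _ _) Ha e).
apply filter_imp; intros n Hn.
change (Rabs (sum_n (fun n => scalar_Re k (a n)) n - scalar_Re k l) < e).
rewrite Hs, <- scalar_Re_minus.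
eapply Rle_lt_trans; [apply Rabs_scalar_Re_le | exact Hn].
Qed.

Lemma norm_series_le (K : AbsRing) (V : NormedModule K) (a : nat -> V) (l : V)
  (b : nat -> R) (m : R) :
  (forall n, norm (a n) <= b n) -> is_series a l -> is_series b m -> norm l <= m.
Proof.
intros Hab Ha Hb.
apply (is_lim_seq_le (fun n => norm (sum_n a n)) (sum_n b) (norm l) m).
- intros n; eapply Rle_trans; [apply norm_sum_n_m |].
  now apply sum_n_m_le.
- apply (filterlim_comp _ _ _ (sum_n a) norm _ (locally l)); [exact Ha |].
  apply filterlim_norm.
- exact Hb.
Qed.

Lemma is_series_le (a b : nat -> R) (l m : R) :
  (forall n, a n <= b n) -> is_series a l -> is_series b m -> l <= m.
Proof.
intros Hab Ha Hb; apply (is_lim_seq_le (sum_n a) (sum_n b) l m).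
- intros n; now apply sum_n_m_le.
- exact Ha.
- exact Hb.
Qed.

Lemma is_series_single (K : AbsRing) (V : NormedModule K) (n : nat) (x : V) :
  is_series (fun m => if Nat.eq_dec m n then x else zero) x.
Proof.
set (a := fun m => if Nat.eq_dec m n then x else zero).
assert (Ha : forall N, sum_n a N = if le_dec n N then x else zero).
{ intros N; induction N as [| N IH].
  - rewrite sum_O; unfold a.
    destruct (Nat.eq_dec 0 n), (le_dec n 0); easy || lia.
  - rewrite sum_Sn, IH; unfold a.
    destruct (le_dec n N), (Nat.eq_dec (S N) n), (le_dec n (S N)); try lia;
      [apply plus_zero_r | apply plus_zero_l | apply plus_zero_l]. }
unfold is_series; apply (filterlim_ext_loc (fun _ => x)).
- exists n; intros N HN; rewrite Ha; now destruct (le_dec n N).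
- apply filterlim_const.
Qed.

(** * The standard basis of [l1] and operators defined on it *)

Lemma is_series_l1_norm (k : scalar_field) (u : l1 k) :
  is_series (fun n => abs (u n)) (norm u).
Proof. exact (Series_correct _ (l1_summable u)). Qed.

Lemma l1_unit_summable (k : scalar_field) (n : nat) :
  ex_series (fun m => abs (if Nat.eq_dec m n then one else @zero (scalars k))).
Proof.
exists 1; apply (is_series_ext (fun m => if Nat.eq_dec m n then 1 else zero)).
- intros m; destruct (Nat.eq_dec m n).
  + now rewrite <- scalar_of_R_one, abs_scalar_of_R, Rabs_R1.
  + now rewrite abs_zero.
- apply is_series_single.
Qed.

Definition l1_unit (k : scalar_field) (n : nat) : l1 k :=
  L1Seq (fun m => if Nat.eq_dec m n then one else zero) (l1_unit_summable k n).

Lemma norm_l1_unit (k : scalar_field) (n : nat) : norm (l1_unit k n) = 1.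
Proof.
apply (is_series_unique_lim _ _ _ _ _ (is_series_l1_norm k (l1_unit k n))).
apply (is_series_ext (fun m => if Nat.eq_dec m n then 1 else zero)).
- intros m; simpl; destruct (Nat.eq_dec m n).
  + now rewrite <- scalar_of_R_one, abs_scalar_of_R, Rabs_R1.
  + now rewrite abs_zero.
- apply is_series_single.
Qed.

Lemma is_linear_l1_coord (k : scalar_field) (n : nat) :
  is_linear (fun u : l1 k => u n : AbsRing_NormedModule (scalars k)).
Proof.
split; try reflexivity.
exists 1; split; [lra |]; intros u; rewrite Rmult_1_l.
exact (l1_norm_abs_le u n).
Qed.

(* Completeness gives a limit of the expansion; its coordinates identify it. *)
Lemma is_series_l1_expansion (k : scalar_field) (u : l1 k) :
  is_series (fun n => scal (u n) (l1_unit k n)) u.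
Proof.
destruct (ex_series_le (fun n => scal (u n) (l1_unit k n)) (fun n => abs (u n)))
  as [v Hv].
- intros n; rewrite norm_scal_eq, norm_l1_unit; lra.
- apply l1_summable.
- enough (E : v = u) by now rewrite E in Hv.
  apply l1_eq; intros m.
  apply (is_series_unique_lim _ _ _ _ _
           (is_series_linear _ _ _ _ _ _ (is_linear_l1_coord k m) Hv)).
  apply (is_series_ext (fun n => if Nat.eq_dec n m then u m else zero)).
  + intros n; simpl; destruct (Nat.eq_dec n m) as [-> | Hn].
    * destruct (Nat.eq_dec m m); [| easy].
      symmetry; exact (mult_one_r (u m)).
    * destruct (Nat.eq_dec m n); [now subst |].
      symmetry; exact (mult_zero_r (u n)).
  + apply is_series_single.
Qed.

Lemma is_series_l1_op (k : scalar_field) (Y : NormedModule (scalars k))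
  (T : l1 k -> Y) (u : l1 k) :
  is_linear T -> is_series (fun n => scal (u n) (T (l1_unit k n))) (T u).
Proof.
intros HT.
apply (is_series_ext (fun n => T (scal (u n) (l1_unit k n)))).
- intros n; apply (linear_scal T HT).
- exact (is_series_linear _ _ _ _ _ _ HT (is_series_l1_expansion k u)).
Qed.

(** Expanding u in the basis, norm (T u) is at most the sum of |u n| norm (T e_n), hence at most M
    norm u. *)
Lemma l1_opnorm_le (k : scalar_field) (Y : NormedModule (scalars k))
  (T : l1 k -> Y) (M : R) :
  is_linear T -> (forall n, norm (T (l1_unit k n)) <= M) -> opnorm T <= M.
Proof.
intros HT HM; apply opnorm_le; [exact HT |]; intros u Hu.
assert (HM0 : 0 <= M) by exact (Rle_trans _ _ _ (norm_ge_0 _) (HM 0%nat)).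
apply Rle_trans with (M * norm u).
- apply (norm_series_le _ _ _ _ (fun n => M * abs (u n)) _) with
    (2 := is_series_l1_op k Y T u HT).
  + intros n; rewrite norm_scal_eq, Rmult_comm.
    apply Rmult_le_compat_r; [apply abs_ge_0 | apply HM].
  + apply (is_series_scal (V := R_NormedModule) M), is_series_l1_norm.
- rewrite <- (Rmult_1_r M) at 2; now apply Rmult_le_compat_l.
Qed.

(** The series of (u n) x_n converges absolutely, so completeness of Y gives it a sum, taken as T u;
    uniqueness of sums gives linearity and the values on the basis. *)
Lemma l1_op_exists (k : scalar_field) (Y : CompleteNormedModule (scalars k))
  (x : nat -> Y) (M : R) :
  (forall n, norm (x n) <= M) ->
  exists T : l1 k -> Y, is_linear T /\ forall n, T (l1_unit k n) = x n.
Proof.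
intros HM.
assert (HM0 : 0 <= M) by exact (Rle_trans _ _ _ (norm_ge_0 _) (HM 0%nat)).
assert (Hb : forall (u : l1 k) n, norm (scal (u n) (x n)) <= M * abs (u n)).
{ intros u n; rewrite norm_scal_eq, Rmult_comm.
  apply Rmult_le_compat_r; [apply abs_ge_0 | apply HM]. }
assert (Hs : forall u : l1 k, is_series (fun n => M * abs (u n)) (M * norm u)).
{ intros u; apply (is_series_scal (V := R_NormedModule) M), is_series_l1_norm. }
assert (HT : forall u : l1 k, exists y : Y, is_series (fun n => scal (u n) (x n)) y).
{ intros u; apply (ex_series_le _ _ (Hb u)); eexists; apply Hs. }
apply choice in HT; destruct HT as [T HT].
exists T; split.
- split.
  + intros u v; apply (is_series_unique_lim _ _ _ _ _ (HT _)).
    apply (is_series_ext (fun n => plus (scal (u n) (x n)) (scal (v n) (x n)))).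
    * intros n; symmetry; exact (scal_distr_r (u n) (v n) (x n)).
    * exact (is_series_plus _ _ _ _ (HT u) (HT v)).
  + intros c u; apply (is_series_unique_lim _ _ _ _ _ (HT _)).
    apply (is_series_ext (fun n => scal c (scal (u n) (x n)))).
    * intros n; exact (scal_assoc c (u n) (x n)).
    * exact (is_series_scal c _ _ (HT u)).
  (* [is_linear] asks for a strictly positive bound, and M may be 0. *)
  + exists (M + 1); split; [lra |]; intros u.
    apply Rle_trans with (M * norm u).
    * exact (norm_series_le _ _ _ _ _ _ (Hb u) (HT u) (Hs u)).
    * apply Rmult_le_compat_r; [apply norm_ge_0 | lra].
- intros n; apply (is_series_unique_lim _ _ _ _ _ (HT _)).
  apply (is_series_ext (fun m => if Nat.eq_dec m n then x n else zero)).
  + intros m; simpl; destruct (Nat.eq_dec m n) as [-> | Hm]; symmetry;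
      [apply scal_one | apply (scal_zero_l (x m))].
  + apply is_series_single.
Qed.

(** * Distance estimates, restricted weights and norm-attaining functionals on [l1] *)

Lemma norm_minus_trans (K : AbsRing) (V : NormedModule K) (y x z : V) :
  norm (minus x z) <= norm (minus x y) + norm (minus y z).
Proof. rewrite (minus_trans y x z); apply norm_triangle. Qed.

Lemma norm_minus_scal (k : scalar_field) (V : NormedModule (scalars k))
  (c d : scalars k) (x : V) :
  norm (minus (scal c x) (scal d x)) = abs (minus c d) * norm x.
Proof.
rewrite <- norm_scal_eq; f_equal; symmetry; exact (scal_minus_distr_r c d x).
Qed.

Lemma restrict_summable (A : nat -> Prop) (a : nat -> R) :
  (forall n, 0 <= a n) -> ex_series a -> ex_series (restrict A a).
Proof.
intros Ha Hs; apply (ex_series_le (V := R_CompleteNormedModule) _ a); [| exact Hs].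
intros n; change (Rabs (restrict A a n) <= a n); unfold restrict.
specialize (Ha n); destruct (excluded_middle_informative (A n));
  rewrite Rabs_pos_eq; lra.
Qed.

Lemma dual_norm_le (k : scalar_field) (Y : NormedModule (scalars k))
  (f : Y -> AbsRing_NormedModule (scalars k)) (y : Y) :
  is_linear f -> opnorm f = 1 -> abs (f y) <= norm y.
Proof.
intros Hf Hf1; generalize (norm_le_opnorm k _ _ f y Hf).
rewrite Hf1, Rmult_1_l; easy.
Qed.

(* A convex combination of points of the unit disc has modulus one only if all
   points carrying weight lie on the unit circle. *)
Lemma attaining_coordinate (k : scalar_field) (u : l1 k)
  (f : l1 k -> AbsRing_NormedModule (scalars k)) (n : nat) :
  is_linear f -> opnorm f <= 1 -> norm u = 1 -> abs (f u) = 1 ->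
  u n <> zero -> abs (f (l1_unit k n)) = 1.
Proof.
intros Hf Hf1 Hu Hfu Hn.
assert (Hw : forall m, abs (f (l1_unit k m)) <= 1).
{ intros m; apply Rle_trans with (opnorm f); [| exact Hf1].
  apply (opnorm_ball_le _ _ _ f); [exact Hf | rewrite norm_l1_unit; lra]. }
apply Rle_antisym; [apply Hw | apply Rnot_lt_le; intros Hlt].
assert (Hpos : 0 < abs (u n)).
{ destruct (abs_ge_0 (u n)) as [H | H]; [exact H |].
  now elim Hn; apply abs_eq_zero. }
(* The terms of f u are dominated by |u m|, lowered at the single index n by the deficit there; the
   sum of these bounds is still at least |f u| = 1. *)
assert (H : 1 <= 1 - abs (u n) * (1 - abs (f (l1_unit k n)))).
{ rewrite <- Hfu at 1; rewrite <- Hu at 1.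
  refine (norm_series_le _ _ _ _ _ _ _ (is_series_l1_op k _ f u Hf)
    (is_series_minus _ _ _ _ (is_series_l1_norm k u)
      (is_series_single R_AbsRing R_NormedModule n
         (abs (u n) * (1 - abs (f (l1_unit k n))))))).
  intros m; rewrite norm_scal_eq.
  assert (Hm := Rmult_le_compat_l _ _ _ (abs_ge_0 (u m)) (Hw m)).
  change (abs (u m) * abs (f (l1_unit k m)) <= abs (u m) -
    (if Nat.eq_dec m n then abs (u n) * (1 - abs (f (l1_unit k n))) else 0)).
  destruct (Nat.eq_dec m n) as [-> | _]; lra. }
assert (0 < abs (u n) * (1 - abs (f (l1_unit k n))))
  by (apply Rmult_lt_0_compat; lra).
lra.
Qed.

(** * From BPBZp of the pair to AHSp of Y *)

Lemma BPBZp_l1_AHSp (k : scalar_field) (Y : CompleteNormedModule (scalars k)) :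
  BPBZp (l1 k) Y -> AHSp Y (dual Y).
Proof.
intros HB eps0 Heps0.
set (eps := Rmin eps0 1).
assert (Heps : 0 < eps) by (apply Rmin_pos; lra).
assert (Hle0 : eps <= eps0) by apply Rmin_l.
assert (Hle1 : eps <= 1) by apply Rmin_r.
(* Quadratic in [eps], because the rotation below costs up to the square root of 8 d, which must be
   at most eps / 2. *)
set (d := eps ^ 2 / 100).
assert (Hd : 0 < d) by (unfold d; nra).
assert (Hde : d <= eps / 100) by (unfold d; nra).
destruct (HB d Hd) as [eta0 [Heta0 HB']]; clear HB.
(* [eta0] allows BPBZp to be applied; [d * d] bounds by (d * d) / d = d the mass of the indices
   where Re x'(x_n) < 1 - d. *)
exists (Rmin eta0 (d * d)); split; [apply Rmin_pos; nra |].
set (eta := Rmin eta0 (d * d)).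
assert (Hetad : eta <= d * d) by apply Rmin_r.
assert (Heta00 : eta <= eta0) by apply Rmin_l.
intros x x' a s Hx Hx' Hx'1 Ha Hapos Hs Hre.
change (is_linear x') in Hx'.
change (norm a) with (l1_norm a) in Ha.
destruct (l1_op_exists k Y x 1 Hx) as [T [HT HTe]].
set (t := opnorm T).
assert (Ht1 : t <= 1).
{ apply l1_opnorm_le; [exact HT |]; intros n; rewrite HTe; apply Hx. }
assert (Hsa : ex_series (fun n => abs (scalar_of_R k (a n)))).
{ apply (ex_series_ext (fun n => abs (a n))); [| apply (l1_summable a)].
  intros n; rewrite abs_scalar_of_R; reflexivity. }
(* The real weights are read as a point of the scalar [l1], at which [T] takes the value [s]. *)
set (b := L1Seq (fun n => scalar_of_R k (a n)) Hsa : l1 k).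
assert (Hb1 : norm b = 1).
{ rewrite <- Ha; apply Series_ext; intros n; simpl.
  rewrite abs_scalar_of_R; reflexivity. }
assert (HTb : T b = s).
{ apply (is_series_unique_lim _ _ _ _ _ (is_series_l1_op k Y T b HT)).
  revert Hs; apply is_series_ext; intros n; now rewrite HTe. }
assert (Hst : abs (x' s) <= t).
{ eapply Rle_trans; [exact (dual_norm_le _ _ _ s Hx' Hx'1) |].
  rewrite <- HTb; unfold t; rewrite <- (Rmult_1_r (opnorm T)), <- Hb1.
  now apply norm_le_opnorm. }
assert (Hres := scalar_Re_le_abs k (x' s)).
assert (Ht : 1 - eta < t) by lra.
assert (Hdd : d * d <= d / 100) by nra.
assert (Ht0 : 0 < t) by lra.
assert (Hti : 1 <= / t) by (rewrite <- Rinv_1; now apply Rinv_le_contravar).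
set (T' := fun v => scal (scalar_of_R k (/ t)) (T v)).
assert (HT' : is_linear T') by now apply is_linear_scal_op.
assert (HT'1 : opnorm T' = 1).
{ unfold T'; rewrite opnorm_scal, abs_scalar_of_R, Rabs_pos_eq by (easy || lra).
  fold t; apply Rinv_l; lra. }
destruct (HB' T' x' b HT' HT'1 Hx' Hx'1 Hb1)
  as (y & u & S & Hy & Hy1 & Hu1 & HS & HS1 & Hatt & Hub & Hyx & HST); clear HB'.
(* Normalising multiplies x'(s) by 1 / t >= 1, which preserves the lower bound. *)
{ unfold T'; rewrite HTb, (linear_scal x' Hx').
  change (abs (mult (scalar_of_R k (/ t)) (x' s)) > 1 - eta0).
  rewrite abs_mult_eq, abs_scalar_of_R, Rabs_pos_eq by lra.
  assert (0 <= (/ t - 1) * abs (x' s))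
    by (apply Rmult_le_pos; [lra | apply abs_ge_0]).
  lra. }
change (is_linear y) in Hy.
assert (HyS : is_linear (fun v => y (S v))) by exact (is_linear_comp S y HS Hy).
assert (HyS1 : opnorm (fun v => y (S v)) <= 1).
{ apply opnorm_le; [exact HyS |]; intros v Hv.
  eapply Rle_trans; [exact (dual_norm_le _ _ _ (S v) Hy Hy1) |].
  rewrite <- HS1; now apply opnorm_ball_le. }
(* One [d] bounds the distance from S to T'; the other bounds the normalisation error (1 / t - 1)
   norm (T e_n) <= 1 - t < eta. *)
assert (HSe : forall n, norm (minus (S (l1_unit k n)) (x n)) <= d + d).
{ intros n.
  eapply Rle_trans; [exact (norm_minus_trans _ Y (T' (l1_unit k n)) _ _) |].
  apply Rplus_le_compat.
  - apply Rlt_le; eapply Rle_lt_trans; [| exact HST].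
    apply (opnorm_ball_le _ _ _ (fun v => minus (S v) (T' v))).
    + now apply is_linear_minus_fun.
    + rewrite norm_l1_unit; lra.
  - unfold T'; rewrite <- (scal_one (x n)), <- HTe, <- scalar_of_R_one.
    rewrite (norm_minus_scal k Y), <- scalar_of_R_minus, abs_scalar_of_R.
    rewrite Rabs_pos_eq by lra.
    apply Rle_trans with ((/ t - 1) * t).
    + apply Rmult_le_compat_l; [lra |].
      apply opnorm_ball_le; [exact HT | rewrite norm_l1_unit; lra].
    + rewrite Rmult_minus_distr_r, Rinv_l; lra. }
set (w := fun n => y (S (l1_unit k n))).
assert (Hwx : forall n, scalar_Re k (x' (x n)) - scalar_Re k (w n) <= 3 * d).
{ intros n; rewrite <- scalar_Re_minus.
  eapply Rle_trans; [apply scalar_Re_le_abs |].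
  rewrite abs_minus; unfold w.
  rewrite (minus_trans (y (x n))).
  eapply Rle_trans; [apply abs_triangle |].
  rewrite <- (linear_minus y) by exact Hy.
  apply Rle_trans with ((d + d) + d); [apply Rplus_le_compat | lra].
  - eapply Rle_trans; [exact (dual_norm_le _ _ _ _ Hy Hy1) | apply HSe].
  - apply Rlt_le; eapply Rle_lt_trans; [| exact Hyx].
    apply (opnorm_ball_le _ _ _ (fun v => minus (y v) (x' v))); [| apply Hx].
    now apply is_linear_minus_fun. }
(* The first condition makes |w n| = 1; the second, with [Hwx], gives Re (w n) >= 1 - 4 d, so that
   the rotation is small. *)
set (A := fun n => u n <> zero /\ 1 - d <= scalar_Re k (x' (x n))).
assert (Hz : forall n, exists z : Y, A n ->
  norm z = 1 /\ norm (minus z (x n)) < eps0 /\ y z = one).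
{ intros n.
  destruct (excluded_middle_informative (A n)) as [HA | HA]; [| now exists zero].
  destruct HA as [Hun HRe].
  assert (Hw1 : abs (w n) = 1)
    by exact (attaining_coordinate k u _ n HyS HyS1 Hu1 Hatt Hun).
  destruct (scalar_unit_inverse k (w n) Hw1) as [c [Hcw Hc2]].
  assert (Hc1 := abs_inverse_unit k c (w n) Hw1 Hcw).
  exists (scal c (S (l1_unit k n))); intros _.
  assert (HSn : norm (S (l1_unit k n)) <= 1).
  { rewrite <- HS1; apply opnorm_ball_le; [exact HS | rewrite norm_l1_unit; lra]. }
  split; [| split].
  (* The norm of S e_n is exactly 1: it is at most that of S, and y, of norm 1, has modulus 1
     there. *)
  - rewrite norm_scal_eq, Hc1, Rmult_1_l; apply Rle_antisym; [exact HSn |].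
    rewrite <- Hw1; exact (dual_norm_le _ _ _ _ Hy Hy1).
  - assert (Hc : abs (minus c one) <= eps / 2).
    { apply Rsqr_incr_0; [| apply abs_ge_0 | lra].
      rewrite !Rsqr_pow2, Hc2; specialize (Hwx n).
      apply Rle_trans with (8 * d); [lra | unfold d; nra]. }
    assert (Hcz := norm_minus_scal k Y c one (S (l1_unit k n))).
    rewrite scal_one in Hcz.
    eapply Rle_lt_trans; [exact (norm_minus_trans _ Y (S (l1_unit k n)) _ _) |].
    apply Rle_lt_trans with (eps / 2 * 1 + (d + d)); [| lra].
    apply Rplus_le_compat; [| apply HSe].
    eapply Rle_trans; [apply Req_le; exact Hcz |].
    apply Rmult_le_compat; [apply abs_ge_0 | apply norm_ge_0 | exact Hc | exact HSn].
  - rewrite (linear_scal y Hy); exact Hcw. }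
apply choice in Hz; destruct Hz as [z Hz].
exists A, z, y; split; [intros n HA; apply (Hz n HA) |].
split; [exact Hy |]; split; [exact Hy1 |].
split; [| split; [| split]].
- assert (Has : ex_series (fun n => a n : R)).
  { apply (ex_series_ext (fun n => abs (a n))); [| apply (l1_summable a)].
    intros n; exact (Rabs_pos_eq _ (Hapos n)). }
  assert (Ha1 : is_series (fun n => a n : R) 1).
  { rewrite <- Ha; apply (is_series_ext (fun n => abs (a n))).
    - intros n; exact (Rabs_pos_eq _ (Hapos n)).
    - exact (is_series_l1_norm Reals a). }
  assert (HRs : is_series (fun n => a n * scalar_Re k (x' (x n))) (scalar_Re k (x' s))).
  { apply (is_series_ext (fun n => scalar_Re k (x' (scal (scalar_of_R k (a n)) (x n))))).
    - intros n; rewrite (linear_scal x' Hx'); apply scalar_Re_mult_of_R.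
    - apply is_series_scalar_Re, is_series_linear; assumption. }
  (* The terms a_n - a_n (1 - Re x'(x_n)) / d - |u n - b n| are at most a_n on A and at most 0 off
     A: if u n = 0 the last part equals a_n, otherwise the middle part is at least a_n. Summing
     bounds the mass of A below by 1 - 2 d. *)
  assert (Hsum := is_series_minus (V := R_NormedModule) _ _ _ _
     (is_series_minus (V := R_NormedModule) _ _ _ _ Ha1
       (is_series_scal (V := R_NormedModule) (/ d) _ _
         (is_series_minus (V := R_NormedModule) _ _ _ _ Ha1 HRs)))
     (is_series_l1_norm k (minus u b))).
  assert (Hres' := Series_correct _ (restrict_summable A _ Hapos Has)).
  assert (Hge : 1 - / d * (1 - scalar_Re k (x' s)) - norm (minus u b)
                <= Series (restrict A a)).
  { refine (is_series_le _ _ _ _ _ Hsum Hres'); intros n.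
    change (a n - / d * (a n - a n * scalar_Re k (x' (x n))) -
      abs (minus (u n) (b n)) <= restrict A a n).
    assert (Han := Hapos n).
    assert (Hdi : 0 < / d) by now apply Rinv_0_lt_compat.
    assert (Hxn : scalar_Re k (x' (x n)) <= 1).
    { eapply Rle_trans; [apply scalar_Re_le_abs |].
      eapply Rle_trans; [exact (dual_norm_le _ _ _ _ Hx' Hx'1) | apply Hx]. }
    assert (Hdef : 0 <= / d * (a n * (1 - scalar_Re k (x' (x n))))).
    { apply Rmult_le_pos; [lra | apply Rmult_le_pos; lra]. }
    assert (Habs := abs_ge_0 (minus (u n) (b n))).
    unfold restrict; destruct (excluded_middle_informative (A n)) as [HA | HA];
      [lra |].
    destruct (excluded_middle_informative (u n = zero)) as [Hun | Hun].
    - assert (abs (minus (u n) (b n)) = a n).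
      { rewrite Hun.
        transitivity (abs (opp (b n))); [exact (f_equal abs (plus_zero_l _)) |].
        transitivity (abs (b n)); [exact (abs_opp (b n)) |]; simpl.
        now rewrite abs_scalar_of_R, Rabs_pos_eq. }
      lra.
    - assert (scalar_Re k (x' (x n)) < 1 - d).
      { apply Rnot_le_lt; intros H; apply HA; now split. }
      assert (a n <= / d * (a n * (1 - scalar_Re k (x' (x n))))).
      { apply Rle_trans with (/ d * (a n * d)); [rewrite (Rmult_comm (a n)), <- Rmult_assoc, Rinv_l; lra |].
        apply Rmult_le_compat_l; [lra |]; apply Rmult_le_compat_l; lra. }
      lra. }
  assert (/ d * (1 - scalar_Re k (x' s)) <= / d * (d * d)).
  { apply Rmult_le_compat_l; [apply Rlt_le, Rinv_0_lt_compat, Hd | lra]. }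
  assert (/ d * (d * d) = d) by (field; lra).
  change (norm (minus u b) < d) in Hub.
  change (Series (restrict A a) > 1 - eps0); lra.
- intros n HA; apply (Hz n HA).
- intros n HA; apply (Hz n HA).
- lra.
Qed.

(** * From AHSp of Y to BPBZp of the pair *)

Lemma AHSp_BPBZp_l1 (k : scalar_field) (Y : CompleteNormedModule (scalars k)) :
  AHSp Y (dual Y) -> BPBZp (l1 k) Y.
Proof.
intros HA eps0 Heps0.
(* The new point moves by less than 2 eps, and the cap at 1 keeps the mass of A, above 1 - eps, away
   from 0. *)
set (eps := Rmin eps0 1 / 3).
assert (Heps : 0 < eps /\ 3 * eps <= eps0 /\ 3 * eps <= 1).
{ generalize (Rmin_l eps0 1) (Rmin_r eps0 1) (Rmin_pos eps0 1 Heps0 Rlt_0_1).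
  unfold eps; lra. }
destruct Heps as [Heps [Hle0 Hle1]].
destruct (HA eps Heps) as [eta [Heta HA']]; clear HA.
exists eta; split; [exact Heta |].
intros T y0 x0 HT HT1 Hy0 Hy01 Hx0 Hatt.
change (is_linear y0) in Hy0.
assert (HTe : forall n, norm (T (l1_unit k n)) <= 1).
{ intros n; rewrite <- HT1; apply opnorm_ball_le; [exact HT |].
  rewrite norm_l1_unit; lra. }
destruct (scalar_phase k (y0 (T x0))) as [th [Hth Hy0T]].
assert (Hinv : forall w : scalars k, abs w = 1 ->
  exists c : scalars k, mult c w = one /\ abs c = 1).
{ intros w Hw; destruct (scalar_unit_inverse k w Hw) as [c [Hc _]].
  exists c; split; [exact Hc | exact (abs_inverse_unit k c w Hw Hc)]. }
destruct (Hinv th Hth) as [ta [Htath Hta]].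
assert (Hp : forall n, exists p : scalars k * scalars k,
  abs (fst p) = 1 /\ x0 n = mult (scalar_of_R k (abs (x0 n))) (fst p) /\
  mult (snd p) (fst p) = one /\ abs (snd p) = 1).
{ intros n; destruct (scalar_phase k (x0 n)) as [p [Hp1 Hp]].
  destruct (Hinv p Hp1) as [q Hq]; now exists (p, q). }
apply choice in Hp; destruct Hp as [pq Hpq].
set (p := fun n => fst (pq n)); set (q := fun n => snd (pq n)).
assert (Hp1 : forall n, abs (p n) = 1) by apply Hpq.
assert (Hxp : forall n, x0 n = mult (scalar_of_R k (abs (x0 n))) (p n)) by apply Hpq.
assert (Hqp : forall n, mult (q n) (p n) = one) by apply Hpq.
assert (Hq1 : forall n, abs (q n) = 1) by apply Hpq.
(* With these phases the sum of |x0 n| x_n is [ta] times T x0, where y0 takes the nonnegative real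
   value |y0 (T x0)|. *)
set (x := fun n => scal (mult ta (p n)) (T (l1_unit k n))).
assert (Has : ex_series (fun n => @abs R_AbsRing (abs (x0 n)))).
{ apply (ex_series_ext (fun n => abs (x0 n))); [| apply (l1_summable x0)].
  intros n; symmetry; exact (Rabs_pos_eq _ (abs_ge_0 _)). }
set (a := @L1Seq (scalars Reals) (fun n => abs (x0 n)) Has : l1 Reals).
destruct (HA' x y0 a (scal ta (T x0))) as (A & z & y & Hz1 & Hy & Hy1 & HAsum & Hzx & Hyz & Hyy0).
- intros n; unfold x; rewrite norm_scal_eq, abs_mult_eq, Hta, Hp1, !Rmult_1_l.
  apply HTe.
- exact Hy0.
- exact Hy01.
- rewrite <- Hx0; apply Series_ext; intros n; exact (Rabs_pos_eq _ (abs_ge_0 _)).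
- intros n; apply abs_ge_0.
- apply (is_series_ext (fun n => scal ta (scal (x0 n) (T (l1_unit k n))))).
  + intros n; unfold x; simpl; rewrite !scal_assoc; f_equal.
    rewrite (Hxp n) at 1.
    rewrite !mult_assoc; f_equal; apply scalars_mult_comm.
  + exact (is_series_scal ta _ _ (is_series_l1_op k Y T x0 HT)).
- rewrite (linear_scal y0 Hy0).
  replace (scal ta (y0 (T x0)) : AbsRing_NormedModule (scalars k))
    with (scalar_of_R k (abs (y0 (T x0)))).
  + rewrite scalar_Re_of_R; exact Hatt.
  + symmetry; rewrite Hy0T at 1.
    change (mult ta (mult (scalar_of_R k (abs (y0 (T x0)))) th)
            = scalar_of_R k (abs (y0 (T x0)))).
    rewrite (scalars_mult_comm _ th), mult_assoc, Htath; apply mult_one_l.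
- change (is_linear y) in Hy.
(* As [th] and [q n] invert [ta] and [p n], the same factor turns x_n back into T e_n; thus v n is
   as close to T e_n as z_n is to x_n. *)
set (v := fun n => if excluded_middle_informative (A n)
                   then scal (mult th (q n)) (z n) else T (l1_unit k n)).
assert (Hthq : forall n, abs (mult th (q n)) = 1).
{ intros n; rewrite abs_mult_eq, Hth, Hq1; lra. }
assert (Hv1 : forall n, norm (v n) <= 1).
{ intros n; unfold v; destruct (excluded_middle_informative (A n)) as [Hn | Hn].
  - rewrite norm_scal_eq, Hthq, Hz1 by easy; lra.
  - apply HTe. }
destruct (l1_op_exists k Y v 1 Hv1) as [S [HS HSv]].
assert (HS1 : opnorm S <= 1).
{ apply l1_opnorm_le; [exact HS |]; intros n; rewrite HSv; apply Hv1. }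
assert (HvT : forall n, norm (minus (v n) (T (l1_unit k n))) <= eps).
{ intros n; unfold v; destruct (excluded_middle_informative (A n)) as [Hn | Hn].
  - replace (T (l1_unit k n)) with (scal (mult th (q n)) (x n)).
    + apply Rle_trans with (norm (scal (mult th (q n)) (minus (z n) (x n)))).
      * apply Req_le, f_equal; symmetry; exact (scal_minus_distr_l (mult th (q n)) (z n) (x n)).
      * rewrite norm_scal_eq, Hthq, Rmult_1_l; apply Rlt_le, Hzx, Hn.
    + unfold x; rewrite scal_assoc.
      rewrite (scalars_mult_comm ta), <- mult_assoc, (mult_assoc (q n)), Hqp.
      rewrite mult_one_l, scalars_mult_comm, Htath; apply (@scal_one _ Y).
  - apply Rle_trans with 0; [| lra]; apply Req_le.
    rewrite <- (@norm_zero _ Y); exact (f_equal norm (plus_opp_r (T (l1_unit k n)))). }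
assert (HST : opdist S T <= eps).
{ apply (l1_opnorm_le k Y (fun u => minus (S u) (T u))).
  - now apply is_linear_minus_fun.
  - intros n; rewrite HSv; apply HvT. }
set (sg := Series (restrict A a)).
assert (Hrs : ex_series (restrict A a)).
{ apply restrict_summable; [intros n; apply abs_ge_0 | apply (l1_summable x0)]. }
assert (Hrsg : is_series (restrict A a) sg) by exact (Series_correct _ Hrs).
assert (Hbabs : forall n,
  abs (if excluded_middle_informative (A n) then x0 n else zero) = restrict A a n).
{ intros n; unfold restrict; destruct (excluded_middle_informative (A n));
    [reflexivity | apply abs_zero]. }
assert (Hbs : ex_series (fun n =>
  abs (if excluded_middle_informative (A n) then x0 n else zero))).
{ apply (ex_series_ext (restrict A a)); [| exact Hrs].
  intros n; symmetry; apply Hbabs. }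
set (b := L1Seq (fun n => if excluded_middle_informative (A n) then x0 n else zero) Hbs
          : l1 k).
assert (Hb : norm b = sg) by (apply Series_ext; exact Hbabs).
change (sg > 1 - eps) in HAsum.
(* The difference vanishes on A and is the opposite of x0 off A, so its norm is the mass missing
   from A. *)
assert (Hbx : norm (minus b x0) = 1 - sg).
{ rewrite <- Hx0.
  apply (is_series_unique_lim _ _ _ _ _ (is_series_l1_norm k (minus b x0))).
  refine (is_series_ext _ _ _ _ (is_series_minus (V := R_NormedModule) _ _ _ _
    (is_series_l1_norm k x0) Hrsg)); intros n.
  change (abs (x0 n) - restrict A a n = abs (minus (b n) (x0 n))).
  unfold restrict; simpl; destruct (excluded_middle_informative (A n)).
  - transitivity (abs (@zero (scalars k))); [rewrite abs_zero; simpl; ring |].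
    symmetry; exact (f_equal abs (plus_opp_r (x0 n))).
  - transitivity (abs (opp (x0 n))); [rewrite abs_opp; simpl; ring |].
    symmetry; exact (f_equal abs (plus_zero_l (opp (x0 n)))). }
assert (Hsg1 : sg <= 1) by (generalize (norm_ge_0 (minus b x0)); lra).
set (x1 := scal (scalar_of_R k (/ sg)) b : l1 k).
assert (Hsg : 0 < / sg) by (apply Rinv_0_lt_compat; lra).
assert (Hx1 : norm x1 = 1).
{ unfold x1; rewrite norm_scal_eq, abs_scalar_of_R, Rabs_pos_eq, Hb by lra.
  apply Rinv_l; lra. }
assert (HyS : is_linear (fun u => y (S u))) by exact (is_linear_comp S y HS Hy).
(* On A all phases cancel because y (z n) = 1: each term becomes (x0 n) (q n) = |x0 n|. *)
assert (HySb : scalar_Re k (mult ta (y (S b))) = sg).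
{ apply (is_series_unique_lim R_AbsRing R_NormedModule (restrict A a)); [| exact Hrsg].
  refine (is_series_ext _ _ _ _ (is_series_scalar_Re k _ _
    (is_series_scal ta _ _ (is_series_l1_op k _ (fun u => y (S u)) b HyS)))).
  intros n; rewrite HSv; unfold v, restrict; simpl.
  destruct (excluded_middle_informative (A n)) as [Hn | Hn].
  - rewrite (linear_scal y Hy), (Hyz n Hn).
    rewrite <- (scalar_Re_of_R k (abs (x0 n))); f_equal.
    change (mult ta (mult (x0 n) (mult (mult th (q n)) one))
            = scalar_of_R k (abs (x0 n))).
    rewrite mult_one_r, (scalars_mult_comm (x0 n)), !mult_assoc, Htath, mult_one_l.
    rewrite (Hxp n) at 1.
    rewrite (scalars_mult_comm _ (p n)), mult_assoc, Hqp; apply mult_one_l.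
  - transitivity (scalar_Re k zero); [f_equal | now destruct k].
    change (mult ta (mult zero (y (T (l1_unit k n)))) = zero).
    rewrite mult_zero_l; apply mult_zero_r. }
assert (HySx1 : 1 <= abs (y (S x1))).
{ unfold x1; rewrite (linear_scal _ HS), (linear_scal y Hy).
  change (1 <= abs (mult (scalar_of_R k (/ sg)) (y (S b)))).
  rewrite abs_mult_eq, abs_scalar_of_R, Rabs_pos_eq by lra.
  rewrite <- (Rinv_l sg) by lra; apply Rmult_le_compat_l; [lra |].
  rewrite <- HySb at 1; eapply Rle_trans; [apply scalar_Re_le_abs |].
  rewrite abs_mult_eq, Hta; lra. }
(* The chain 1 <= |y (S x1)| <= norm (S x1) <= opnorm S <= 1 collapses, giving both the norm of S
   and its attainment. *)
assert (HSx1 : norm (S x1) <= opnorm S).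
{ apply opnorm_ball_le; [exact HS | rewrite Hx1; lra]. }
assert (HyS1 := dual_norm_le k Y y (S x1) Hy Hy1).
exists y, x1, S.
split; [exact Hy |]; split; [exact Hy1 |]; split; [exact Hx1 |].
split; [exact HS |]; split; [lra |]; split; [lra |].
split; [| split; lra].
eapply Rle_lt_trans; [exact (norm_minus_trans _ _ b x1 x0) |].
(* Normalising b costs 1 - sg and restricting x0 to A costs another 1 - sg, each below [eps]. *)
apply Rle_lt_trans with ((/ sg - 1) * sg + (1 - sg)).
+ apply Rplus_le_compat; [| exact (Req_le _ _ Hbx)].
  assert (H := norm_minus_scal k _ (scalar_of_R k (/ sg)) (scalar_of_R k 1) b).
  rewrite <- scalar_of_R_minus, abs_scalar_of_R, Hb in H.
  rewrite scalar_of_R_one, scal_one, Rabs_pos_eq in H.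
  * apply Req_le; exact H.
  * assert (1 <= / sg) by (rewrite <- Rinv_1; apply Rinv_le_contravar; lra); lra.
+ rewrite Rmult_minus_distr_r, Rinv_l; lra.
Qed.

Theorem theorem3p3 (k : scalar_field) (Y : CompleteNormedModule (scalars k)) :
  BPBZp (l1 k) Y <-> AHSp Y (dual Y).
Proof. split; [apply BPBZp_l1_AHSp | apply AHSp_BPBZp_l1]. Qed.
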